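(* Let $T(z)=\frac{1-z}{1-2z}$ and let $$\mathcal J(z;x,u,v)=\sum_{\alpha\ne\varnothing}x^{P(\alpha)}u^{K(\alpha)}v^{S(\alpha)}z^{|\alpha|},$$ the sum being over all nonempty integer compositions $\alpha$. Then, as formal power series, $$\mathcal J(z;x,u,v)=T(z)\sum_{p\ge1}x^p(1-z^p)\frac{u(vz)^p}{1-u(vz)^p}.$$
   Context: An integer composition of $n\ge1$ is an ordered sequence $\alpha=(a_1,\ldots,a_\ell)$ of integers $a_i\ge1$ with $a_1+\cdots+a_\ell=n$; write $|\alpha|=n$. For a nonempty composition $\alpha=(a_1,\ldots,a_\ell)$, its initial run is the maximal prefix $(a_1,\ldots,a_k)$ whose entries are all equal; put $P(\alpha)=a_1$, $K(\alpha)=k$ (the number of parts in the initial run), and $S(\alpha)=P(\alpha)K(\alpha)$. The series $T(z)=\frac{1-z}{1-2z}=1+\sum_{n\ge1}2^{n-1}z^n$ is the generating function of all compositions including the empty one. *)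

(* Defs.v *)
From HB Require Import structures.
From mathcomp Require Import all_boot all_order all_algebra.
From mathcomp Require Import mpoly.
From mathcomp Require Import boolp classical_sets cardinality fsbigop.

Set Implicit Arguments.
Unset Strict Implicit.
Unset Printing Implicit Defensive.

Import GRing.Theory.
Local Open Scope ring_scope.

(* The ring R[[X_0, ..., X_(n-1)]] of formal power series: a series is its
   family of coefficients, indexed by the monomials 'X_{1..n}. *)
Record fps (n : nat) (R : Type) : Type :=
  FPS { fps_coef : 'X_{1..n} -> R }.

HB.instance Definition _ n R := gen_eqMixin (fps n R).
HB.instance Definition _ n R := gen_choiceMixin (fps n R).

Lemma fpsP n R (f g : fps n R) :
  (forall m, fps_coef f m = fps_coef g m) -> f = g.
Proof. by case: f g => [f] [g] /= fg; congr FPS; apply/funext. Qed.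

Section FpsRing.
Context (n : nat) (R : comNzRingType).
Implicit Types (f g h : fps n R) (m : 'X_{1..n}).

Definition fps_zero : fps n R := FPS (fun=> 0).
Definition fps_opp f : fps n R := FPS (fun m => - fps_coef f m).
Definition fps_add f g : fps n R := FPS (fun m => fps_coef f m + fps_coef g m).

Fact fps_addA : associative fps_add.
Proof. by move=> f g h; apply: fpsP => m /=; rewrite addrA. Qed.
Fact fps_addC : commutative fps_add.
Proof. by move=> f g; apply: fpsP => m /=; rewrite addrC. Qed.
Fact fps_add0 : left_id fps_zero fps_add.
Proof. by move=> f; apply: fpsP => m /=; rewrite add0r. Qed.
Fact fps_addN : left_inverse fps_zero fps_opp fps_add.
Proof. by move=> f; apply: fpsP => m /=; rewrite addNr. Qed.

HB.instance Definition _ := GRing.isZmodule.Build (fps n R)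
  fps_addA fps_addC fps_add0 fps_addN.

Definition fps_one : fps n R := FPS (fun m => (m == 0%MM)%:R).

(* Cauchy product; the bound on the degrees only makes the index type finite. *)
Definition fps_mul f g : fps n R := FPS (fun m =>
  \sum_(k : 'X_{1..n < (mdeg m).+1, (mdeg m).+1} | m == (k.1 + k.2)%MM)
     fps_coef f k.1 * fps_coef g k.2).

Definition fps_trunc d f : {mpoly R[n]} :=
  \sum_(m : 'X_{1..n < d}) fps_coef f m *: 'X_[m].

Lemma fps_truncE d f m : (mdeg m < d)%N -> (fps_trunc d f)@_m = fps_coef f m.
Proof. exact: mcoeff_mpoly. Qed.

Lemma fps_mulE d (p q : {mpoly R[n]}) f g m : (mdeg m < d)%N ->
  (forall k, (mdeg k < d)%N -> p@_k = fps_coef f k) ->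
  (forall k, (mdeg k < d)%N -> q@_k = fps_coef g k) ->
  fps_coef (fps_mul f g) m = (p * q)@_m.
Proof.
move=> md pf qg; rewrite mcoeffM /=; apply: eq_bigr => -[k1 k2] /= _.
by rewrite pf ?qg//; apply: leq_trans (bmdeg _) md.
Qed.

Fact fps_mulA : associative fps_mul.
Proof.
move=> f g h; apply: fpsP => m; set d := (mdeg m).+1.
pose t := fps_trunc d; have tE := fps_truncE (d := d).
have E f1 f2 k : (mdeg k < d)%N -> (t f1 * t f2)@_k = fps_coef (fps_mul f1 f2) k.
  by move=> kd; rewrite (fps_mulE (d := d) kd (tE f1) (tE f2)).
rewrite (fps_mulE (d := d) (ltnSn _) (tE f) (E g h)).
by rewrite (fps_mulE (d := d) (ltnSn _) (E f g) (tE h)) mulrA.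
Qed.

Fact fps_mulC : commutative fps_mul.
Proof.
move=> f g; apply: fpsP => m; have tE := fps_truncE (d := (mdeg m).+1).
by rewrite !(fps_mulE (ltnSn _) (tE _) (tE _)) mulrC.
Qed.

Fact fps_mul1 : left_id fps_one fps_mul.
Proof.
move=> f; apply: fpsP => m; have tE := fps_truncE (d := (mdeg m).+1).
by rewrite (fps_mulE (p := 1) (ltnSn _) _ (tE _)) ?mul1r ?tE // => k _;
  rewrite mcoeff1.
Qed.

Fact fps_mulDl : left_distributive fps_mul fps_add.
Proof.
move=> f g h; apply: fpsP => m; rewrite /= -big_split /=.
by apply: eq_bigr => k _; rewrite mulrDl.
Qed.

Fact fps_one_neq0 : fps_one != fps_zero.
Proof.
apply/eqP => /(congr1 (@fps_coef n R))/(congr1 (@^~ 0%MM)) /= /eqP.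
by rewrite eqxx oner_eq0.
Qed.

HB.instance Definition _ := GRing.Zmodule_isComNzRing.Build (fps n R)
  fps_mulA fps_mulC fps_mul1 fps_mulDl fps_one_neq0.

Definition fps_unit : {pred fps n R} := fun f => `[< exists g, g * f = 1 >].
Definition fps_inv f : fps n R :=
  if pselect (exists g, g * f = 1) is left e then projT1 (cid e) else f.

Fact fps_mulVx : {in fps_unit, left_inverse 1 fps_inv *%R}.
Proof. by move=> f /asboolP ?; rewrite /fps_inv; case: pselect => // e; case: cid. Qed.
Fact fps_unitPl f g : g * f = 1 -> fps_unit f.
Proof. by move=> gf; apply/asboolP; exists g. Qed.
Fact fps_inv_out : {in [predC fps_unit], fps_inv =1 id}.
Proof.
by move=> f /negP nuf; rewrite /fps_inv; case: pselect => // e; case: nuf; apply/asboolP.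
Qed.

HB.instance Definition _ := GRing.ComNzRing_hasMulInverse.Build (fps n R)
  fps_mulVx fps_unitPl fps_inv_out.

Definition fpsX (i : 'I_n) : fps n R := FPS (fun m => (m == U_(i)%MM)%:R).

(* A family of series is summable when every monomial occurs in only finitely
   many members; its sum is then taken coefficientwise.  On a family that is not
   summable, fps_sum puts 0 at the monomials where summability fails. *)
Definition fps_summable (I : choiceType) (D : set I) (F : I -> fps n R) : Prop :=
  forall m, finite_set [set i | D i /\ fps_coef (F i) m != 0].

Definition fps_sum (I : choiceType) (D : set I) (F : I -> fps n R) : fps n R :=
  FPS (fun m => \sum_(i \in D) fps_coef (F i) m).

Definition fps_order_ge d f : Prop :=
  forall m, (mdeg m < d)%N -> fps_coef f m = 0.

Lemma fps_order_ge0 f : fps_order_ge 0 f. Proof. by []. Qed.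

Lemma fps_order_ge_leq c d f : (c <= d)%N -> fps_order_ge d f -> fps_order_ge c f.
Proof. by move=> cd fd m mc; apply: fd; apply: leq_trans mc cd. Qed.

Lemma fps_order_geM c d f g :
  fps_order_ge c f -> fps_order_ge d g -> fps_order_ge (c + d) (f * g).
Proof.
move=> fc gd m mcd; apply: big1 => -[k1 k2] /= /eqP mE.
have [k1c|k1c] := ltnP (mdeg k1) c; first by rewrite fc // mul0r.
have [k2d|k2d] := ltnP (mdeg k2) d; first by rewrite gd // mulr0.
have := leq_add k1c k2d; rewrite -mdegD -mE => cdm.
by move: mcd; rewrite ltnNge cdm.
Qed.

Lemma fps_order_geX d k f : fps_order_ge d f -> fps_order_ge (k * d) (f ^+ k).
Proof.
move=> fd; elim: k => [|k IH]; first exact: fps_order_ge0.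
by rewrite exprS mulSn; apply: fps_order_geM.
Qed.

Lemma fps_order_ge_fpsX i : fps_order_ge 1 (fpsX i).
Proof.
move=> m; rewrite ltnS leqn0 mdeg_eq0 => /eqP -> /=; case: eqP => // /(congr1 mdeg).
by rewrite mdeg0 mdeg1.
Qed.

Lemma fps_coefD f g m : fps_coef (f + g) m = fps_coef f m + fps_coef g m.
Proof. by []. Qed.

Lemma fps_coefN f m : fps_coef (- f) m = - fps_coef f m.
Proof. by []. Qed.

Lemma fps_coefM_trunc d f g h m : (mdeg m < d)%N ->
  (forall k, (mdeg k < d)%N -> fps_coef g k = fps_coef h k) ->
  fps_coef (f * g) m = fps_coef (f * h) m.
Proof.
move=> md gh; apply: eq_bigr => -[k1 k2] /= _; congr (_ * _); apply: gh.
exact: leq_trans (bmdeg _) md.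
Qed.

Lemma fps_unit1B f : fps_order_ge 1 f -> 1 - f \is a GRing.unit.
Proof.
move=> f1; pose G d : fps n R := \sum_(i < d) f ^+ i.
pose g : fps n R := FPS (fun m => fps_coef (G (mdeg m).+1) m).
have fX d : fps_order_ge d (f ^+ d) by rewrite -[d in fps_order_ge d]muln1; apply: fps_order_geX.
have GE d m : (mdeg m < d)%N -> fps_coef (G d) m = fps_coef g m.
  elim: d => // d IH; rewrite ltnS leq_eqVlt => /predU1P[<- //|md].
  by rewrite /G big_ord_recr fps_coefD -/(G d) IH // fX // addr0.
suff fg : (1 - f) * g = 1 by apply: (@fps_unitPl _ g); rewrite mulrC.
apply: fpsP => m; have md := ltnSn (mdeg m).
rewrite -(fps_coefM_trunc _ md (fun k => @GE _ k)) -opprB mulNr -subrX1 opprB.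
by rewrite fps_coefD fps_coefN fX // subr0.
Qed.

Lemma fps_order_geMl d f g : fps_order_ge d f -> fps_order_ge d (f * g).
Proof. by move=> fd; rewrite -[d]addn0; apply: fps_order_geM. Qed.

Lemma fps_order_geMr d f g : fps_order_ge d g -> fps_order_ge d (f * g).
Proof. by rewrite mulrC; apply: fps_order_geMl. Qed.

Lemma fps_summable_order (I : choiceType) (D : set I) (F : I -> fps n R)
    (w : I -> nat) :
  (forall i, D i -> fps_order_ge (w i) (F i)) ->
  (forall d, finite_set [set i | D i /\ (w i <= d)%N]) -> fps_summable D F.
Proof.
move=> Fw wfin m; apply: sub_finite_set (wfin (mdeg m)) => i /= [Di nz]; split=> //.
by rewrite leqNgt; apply: contra nz => /(Fw _ Di) ->.
Qed.

End FpsRing.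
Arguments fpsX {n R} i.

Definition composition (a : seq nat) : bool := all (leq 1) a.

Definition nonempty_compositions : set (seq nat) :=
  [set a | composition a /\ a <> [::]].

Definition initial_run (a : seq nat) : seq nat :=
  take (\max_(k < (size a).+1 | constant (take k a)) k) a.

Definition compP (a : seq nat) : nat := head 0%N a.
Definition compK (a : seq nat) : nat := size (initial_run a).
Definition compS (a : seq nat) : nat := (compP a * compK a)%N.

Section Series.
Context (R : comNzRingType).

Definition varz : fps 4 R := fpsX (Ordinal (isT : 0 < 4)%N).
Definition varx : fps 4 R := fpsX (Ordinal (isT : 1 < 4)%N).
Definition varu : fps 4 R := fpsX (Ordinal (isT : 2 < 4)%N).
Definition varv : fps 4 R := fpsX (Ordinal (isT : 3 < 4)%N).

Implicit Types z x u v : fps 4 R.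

Definition Tgf z : fps 4 R := (1 - z) / (1 - 2%:R * z).

Definition Jterm z x u v (a : seq nat) : fps 4 R :=
  x ^+ compP a * u ^+ compK a * v ^+ compS a * z ^+ sumn a.

Definition Jgf z x u v : fps 4 R :=
  fps_sum nonempty_compositions (Jterm z x u v).

(* The denominators are units and the families are summable, so that neither the
   inverse nor fps_sum takes a junk value here. *)
Lemma Tgf_unit : 1 - 2%:R * varz \is a GRing.unit.
Proof. exact/fps_unit1B/fps_order_geMr/fps_order_ge_fpsX. Qed.

Lemma run_denom_unit p : 1 - varu * (varv * varz) ^+ p \is a GRing.unit.
Proof. exact/fps_unit1B/fps_order_geMl/fps_order_ge_fpsX. Qed.

Lemma Jterm_summable : fps_summable nonempty_compositions (Jterm varz varx varu varv).
Proof.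
apply: (@fps_summable_order _ _ _ _ _ sumn) => [a _|d].
  apply: fps_order_geMr; rewrite -[d in fps_order_ge d]muln1.
  exact/fps_order_geX/fps_order_ge_fpsX.
apply: (@sub_finite_set _ _ ((fun b : d.-bseq 'I_d.+1 => map val b) @` setT)); last first.
  exact/finite_image/finite_finset.
move=> a /= [[ca _] ad]; have sz_a : (size [seq inord i : 'I_d.+1 | i <- a] <= d)%N.
  rewrite size_map; apply: leq_trans ad.
  by elim: a ca => //= i a IH /andP[i0 /IH]; apply: leq_add i0.
exists (Bseq sz_a) => //=; rewrite -map_comp -[RHS]map_id.
apply/eq_in_map => i ia /=; rewrite inordK // ltnS; apply: leq_trans ad.
elim: a ia {ca sz_a} => //= j a IH; rewrite inE => /predU1P[->|/IH]; first exact: leq_addr.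
by move=> /leq_trans; apply; apply: leq_addl.
Qed.

Lemma run_sum_summable :
  let z := varz in let x := varx in let u := varu in let v := varv in
  fps_summable [set p : nat | (1 <= p)%N]
    (fun p => x ^+ p * (1 - z ^+ p) *
              ((u * (v * z) ^+ p) / (1 - u * (v * z) ^+ p))).
Proof.
move=> z x u v; apply: (@fps_summable_order _ _ _ _ _ id) => [p _|d].
  rewrite -mulrA; apply: fps_order_geMl.
  rewrite -[p in fps_order_ge p]muln1; exact/fps_order_geX/fps_order_ge_fpsX.
by apply: sub_finite_set (finite_II d.+1) => p [].
Qed.

End Series.

(* Main.v *)
Require Import Defs.
From HB Require Import structures.
From mathcomp Require Import all_boot all_order all_algebra.
From mathcomp Require Import mpoly.
From mathcomp Require Import boolp classical_sets cardinality fsbigop.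
From mathcomp Require Import ring.

Set Implicit Arguments.
Unset Strict Implicit.
Unset Printing Implicit Defensive.

Import GRing.Theory.
Local Open Scope ring_scope.

(** Fix p >= 1 and put w = u (vz)^p, the weight of one part p inside the initial
run.  A nonempty composition with first part p is p :: b, and there are two
cases.  If b does not start with p, the initial run is the single part p, and
the term of p :: b is x^p w z^|b|.  If b starts with p, the initial runs of b
and of p :: b differ by one part, and the term of p :: b is w times the term
of b.  The sum J_p over the compositions with first part p therefore satisfies
  J_p = x^p w A_p + w J_p,
where A_p counts by size the compositions, possibly empty, that do not start
with p; since 1 - w is invertible, no geometric series has to be expanded
([Jsum_from]).  Prepending p matches all compositions with those starting with
p, so A_p = (1 - z^p) T ([size_series_head_neq]).

The closed form of T is also found from a self-similarity
([size_series_compositions]): a nonempty composition either starts with 1,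
followed by any composition, or arises from a nonempty composition by adding 1
to its first part, so that T - 1 = z T + z (T - 1).

The sums are infinite, and the steps rest on four rules for sums of summable
families of power series: splitting along a subset ([fps_sumID]), reindexing by
an injection ([fps_sum_image]), summing fiber by fiber ([fps_sum_fibers]), which
recovers the total from the J_p, and multiplying by a fixed series
([fps_sumMl]). *)

(** * Summable families of power series *)

Section FpsSum.
Context (n : nat) (R : comNzRingType).
Implicit Types (f : fps n R).

Lemma eq_fps_sum (I : choiceType) (D : set I) (F G : I -> fps n R) :
  (forall i, D i -> F i = G i) -> fps_sum D F = fps_sum D G.
Proof.
by move=> FG; apply: fpsP => m; apply: eq_fsbigr => i; rewrite inE => /FG ->.
Qed.

Lemma fps_summable_sub (I : choiceType) (D E : set I) (F : I -> fps n R) :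
  (E `<=` D)%classic -> fps_summable D F -> fps_summable E F.
Proof. by move=> ED Fs m; apply: sub_finite_set (Fs m) => i /= [/ED]. Qed.

Lemma fps_sum_set1 (I : choiceType) (i : I) (F : I -> fps n R) :
  fps_sum [set i]%classic F = F i.
Proof. by apply: fpsP => m; rewrite /= fsbig_set1. Qed.

Lemma fps_sum_image (I J : choiceType) (D : set I) (h : I -> J)
    (F : J -> fps n R) :
  injective h -> fps_sum (h @` D)%classic F = fps_sum D (F \o h).
Proof.
by move=> hI; apply: fpsP => m; apply: fsbig_image => i j _ _; apply: hI.
Qed.

Lemma fps_sumID (I : choiceType) (B D : set I) (F : I -> fps n R) :
  fps_summable D F ->
  fps_sum D F = fps_sum (D `&` B)%classic F + fps_sum (D `&` ~` B)%classic F.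
Proof.
move=> Fs; apply: fpsP => m; rewrite fps_coefD /= [LHS]fsbig_supp.
rewrite (fsbigID B); last by apply: sub_finite_set (Fs m) => i [Di /eqP].
by rewrite [in RHS]fsbig_supp [X in _ = _ + X]fsbig_supp; congr (_ + _);
  apply: eq_fsbigl; rewrite setIAC.
Qed.

(** At a given monomial only finitely many members contribute, so this is an
exchange of two finite sums: over these members, and over the values that [h]
takes on them. *)
Lemma fps_sum_fibers (I J : choiceType) (D : set I) (E : set J) (h : I -> J)
    (F : I -> fps n R) :
  fps_summable D F -> (forall i, D i -> E (h i)) ->
  fps_sum D F = fps_sum E (fun j => fps_sum (D `&` [set i | h i = j])%classic F).
Proof.
move=> Fs hDE; apply: fpsP => m /=.
pose S := (D `&` [set i | fps_coef (F i) m <> 0])%classic.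
have Sfin : finite_set S by apply: sub_finite_set (Fs m) => i [Di /eqP].
rewrite [LHS]fsbig_supp -/S.
have inner j : \sum_(i \in (D `&` [set i | h i = j])%classic) fps_coef (F i) m =
    \sum_(i \in S) (if h i == j then fps_coef (F i) m else 0).
  rewrite [LHS]fsbig_supp setIAC fsbig_mkcondr; apply: eq_fsbigr => i _.
  by case: eqP => hij; [rewrite mem_set | rewrite memNset].
under [in RHS]eq_fsbigr do rewrite inner.
rewrite -(@fsbig_widen _ _ _ _ (h @` S)%classic); first last.
- move=> j [_ /= nj]; apply: fsbig1 => i Si; case: eqP => // hij.
  by case: nj; exists i.
- by move=> _ [i [Di _] <-]; apply: hDE.
rewrite exchange_fsbig //; last exact: finite_image.
apply: eq_fsbigr => i; rewrite inE => Si.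
rewrite -(@fsbig_widen _ _ _ _ [set h i]%classic).
- by rewrite fsbig_set1 eqxx.
- by move=> _ ->; exists i.
- by move=> j [_ /= /eqP]; rewrite eq_sym => /negPf ->.
Qed.

(** Only finitely many monomials have degree less than [d], and each occurs in
finitely many members; the finite list [s] of all these members serves every
monomial of degree less than [d] and every factor [f] at once. *)
Lemma fps_sum_trunc (I : choiceType) (D : set I) (F : I -> fps n R) d :
  fps_summable D F ->
  exists s : seq I,
    forall f m, (mdeg m < d)%N ->
      fps_coef (fps_sum D (fun i => f * F i)) m =
      fps_coef (\sum_(i <- s) f * F i) m.
Proof.
move=> Fs.
have fin : finite_set (\bigcup_(k in [set: 'X_{1..n < d}])
    [set i | D i /\ fps_coef (F i) k != 0])%classic.
  by apply: bigcup_finite => [|k _]; [exact: finite_finset | exact: Fs].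
have /finite_seqP[s0 s0E] := fin; exists (undup s0) => f m md.
have Fout i : D i -> i \notin undup s0 -> fps_order_ge d (F i).
  move=> Di; rewrite mem_undup => is0 k kd; apply/eqP/negPn/negP => nz.
  have : [set` s0]%classic i by rewrite -s0E; exists (BMultinom kd).
  by rewrite /= (negPf is0).
have sD i : i \in undup s0 -> D i.
  rewrite mem_undup => is0; have : [set` s0]%classic i by [].
  by rewrite -s0E => -[k _ []].
rewrite (big_morph (fun g => fps_coef g m) (fun g1 g2 => fps_coefD g1 g2 m)
  (erefl : fps_coef 0 m = 0)).
transitivity (\sum_(i \in D) fps_coef (f * F i) m); first by [].
rewrite (@fsbigE _ _ _ _ _ (undup s0)) ?undup_uniq //; last first.
  by move=> i Di /(Fout _ Di) Fi; apply: (fps_order_geMr f Fi).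
rewrite big_seq_cond (eq_bigl (mem (undup s0))) -?big_seq; last first.
  move=> i; rewrite -[RHS]andbT; apply: andb_id2l => /sD Di.
  exact: mem_set.
by [].
Qed.

(** Distributivity at a single monomial is not enough: a coefficient of the
product involves many coefficients of the sum, and all of them must be computed
by the same finite subsum. *)
Lemma fps_sumMl (I : choiceType) (D : set I) f (F : I -> fps n R) :
  fps_summable D F -> f * fps_sum D F = fps_sum D (fun i => f * F i).
Proof.
move=> Fs; apply: fpsP => m; have [s sE] := fps_sum_trunc (mdeg m).+1 Fs.
rewrite sE // -mulr_sumr; apply: (@fps_coefM_trunc _ _ (mdeg m).+1) => // k kd.
have := sE 1 k kd; rewrite -mulr_sumr mul1r => <-.
by congr fps_coef; apply: eq_fps_sum => i _; rewrite mul1r.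
Qed.

End FpsSum.

(** * Compositions and their initial runs *)

(** The run of [p :: b] consists of [p] and the leading entries of [b] equal to
[p], because a prefix [p :: take k b] is constant exactly when [k] does not pass
the first entry of [b] different from [p]. *)
Lemma compK_cons p b : compK (p :: b) = (find (predC1 p) b).+1.
Proof.
have szf : (find (predC1 p) b <= size b)%N := find_size _ _.
have prefix k : (k <= size b)%N ->
    all (pred1 p) (take k b) = (k <= find (predC1 p) b)%N.
  elim: b k {szf} => [|q b IH] [|k] //=; rewrite ltnS => kb.
  by case: eqP => //= _; rewrite IH.
rewrite /compK /initial_run size_take_min; set M := (\max_(_ < _ | _) _)%N.
suff -> : M = (find (predC1 p) b).+1 by apply/minn_idPl.
apply/eqP; rewrite eqn_leq; apply/andP; split.
  apply/bigmax_leqP => -[[|k] kb] //= ck.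
  by rewrite ltnS -prefix //; case: (take k b) ck.
have fb : ((find (predC1 p) b).+1 < (size (p :: b)).+1)%N by [].
apply: (bigmax_sup (Ordinal fb)) => //=.
by have := prefix _ szf; rewrite leqnn; case: (take _ b).
Qed.

Definition compositions : set (seq nat) := [set a | composition a].

Lemma finite_compositions d :
  finite_set [set a | composition a /\ (sumn a <= d)%N].
Proof.
elim: d => [|d IH].
  by apply: sub_finite_set (finite_set1 [::]) => -[|[|p] a] // [].
apply: (@sub_finite_set _ _ ([set [::]] `|`
    (image2 `I_d.+2 [set a | composition a /\ (sumn a <= d)%N] cons))%classic).
  move=> [|p a] /= [ca ad]; [by left | right].
  have /andP[p0 ca'] : (0 < p)%N && composition a by [].
  exists p; first by rewrite ltnS; apply: leq_trans ad; apply: leq_addr.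
  exists a => //; split=> //; rewrite -ltnS; apply: leq_trans ad.
  by rewrite -[X in (X <= _)%N]add1n leq_add2r.
by rewrite finite_setU; split; [exact: finite_set1 | exact: finite_image2].
Qed.

(** * The generating functions *)

Section CompositionSeries.
Context (R : comNzRingType).
Let z := varz R.
Let x := varx R.
Let u := varu R.
Let v := varv R.

Lemma size_series_summable (D : set (seq nat)) :
  (D `<=` compositions)%classic ->
  fps_summable D (fun a => z ^+ sumn a).
Proof.
move=> DC; apply: (fps_summable_order (w := sumn)) => [a _|d].
  rewrite -[d in fps_order_ge d]muln1.
  exact/fps_order_geX/fps_order_ge_fpsX.
by apply: sub_finite_set (finite_compositions d) => a [/DC].
Qed.

Definition size_series (D : set (seq nat)) : fps 4 R :=
  fps_sum D (fun a => z ^+ sumn a).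

Lemma size_series_cons p D : (D `<=` compositions)%classic ->
  size_series (cons p @` D)%classic = z ^+ p * size_series D.
Proof.
move=> DC; rewrite /size_series fps_sum_image; last by move=> a b [].
rewrite fps_sumMl; last exact: size_series_summable.
by apply: eq_fps_sum => a _; rewrite /= exprD.
Qed.

Lemma size_series_nonempty :
  size_series compositions = 1 + size_series nonempty_compositions.
Proof.
rewrite /size_series (fps_sumID [set [::]]%classic); last first.
  exact: size_series_summable.
congr (_ + _); rewrite -[RHS]/(z ^+ sumn [::]).
rewrite -[RHS](fps_sum_set1 _ (fun a => z ^+ sumn a)).
by congr fps_sum; apply/seteqP; split=> a /= => [[]|->].
Qed.

Definition incr_head (a : seq nat) : seq nat :=
  if a is p :: b then p.+1 :: b else [::].

(** The first summand collects the compositions starting with 1, the second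
those whose first part is at least 2, obtained by [incr_head]. *)
Lemma size_series_grow :
  size_series nonempty_compositions =
  z * size_series compositions + z * size_series nonempty_compositions.
Proof.
have sub : (nonempty_compositions `<=` compositions)%classic by move=> a [].
rewrite {1}/size_series (fps_sumID [set a | head 0%N a = 1%N]%classic); last first.
  exact: size_series_summable.
congr (_ + _).
  rewrite -[X in X * _]expr1 -size_series_cons //; congr fps_sum.
  apply/seteqP; split=> [[|p a] /= [[ca _] //= p1]|_ [a ca <-]] //=.
  by rewrite p1; exists a => //; case/andP: ca.
rewrite fps_sumMl; last exact: size_series_summable.
transitivity (fps_sum (incr_head @` nonempty_compositions)%classic
                (fun a => z ^+ sumn a)); last first.
  rewrite fps_sum_image; last by move=> [|p a] [|q b] //= [-> ->].
  by apply: eq_fps_sum => -[|p a] [] //= _ _; rewrite addSn exprS.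
congr fps_sum; apply/seteqP; split.
  move=> [|[|[|p]] a] [[ca _] //= _].
  by exists (p.+1 :: a).
move=> _ [[|p a] [ca _] //= <-].
by split; [split=> //; case/andP: ca | case: p ca].
Qed.

Lemma size_series_compositions : size_series compositions = Tgf z.
Proof.
apply: (canRL (mulrK (Tgf_unit R))).
have := size_series_grow; rewrite size_series_nonempty -/z.
move: (size_series _) => N NE.
(* [NE] determines [N] only through itself: a copy of [N] is made to which it
   can be applied, after which the goal is a polynomial identity. *)
have -> : 1 - z = 1 + (N - N) - z by ring.
by rewrite {3}NE; ring.
Qed.

(** The compositions starting with [p] are [p :: b] for arbitrary compositions
[b], and are to be removed from all compositions.  Positivity of [p] matters for
[b = [::]], whose default head is 0. *)
Lemma size_series_head_neq p : (0 < p)%N ->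
  size_series [set b | composition b /\ head 0%N b <> p] =
  (1 - z ^+ p) * Tgf z.
Proof.
move=> p0; rewrite -size_series_compositions mulrBl mul1r.
rewrite {1}[size_series compositions](fps_sumID [set b | head 0%N b = p]%classic);
  last exact: size_series_summable.
rewrite -size_series_cons //.
suff -> : (cons p @` compositions =
    compositions `&` [set b | head 0%N b = p])%classic.
  by rewrite [X in X - _]addrC addrK.
apply/seteqP; split=> [_ [b cb <-]|[|q b] /= [cb qp]].
- by split=> //; rewrite /compositions /= p0.
- by rewrite -qp in p0.
- by exists b; [case/andP: cb | rewrite qp].
Qed.

Definition compositions_from p : set (seq nat) :=
  [set a | nonempty_compositions a /\ compP a = p].

Let w p : fps 4 R := u * (v * z) ^+ p.

Lemma Jterm_cons_neq p b : head 0%N b <> p -> (0 < p)%N ->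
  Jterm z x u v (p :: b) = x ^+ p * w p * z ^+ sumn b.
Proof.
move=> bp p0; rewrite /Jterm /compS compK_cons /= (_ : find _ _ = 0%N).
  by rewrite expr1 muln1 exprD /w exprMn; ring.
by case: b bp => //= q b /eqP ->.
Qed.

Lemma Jterm_cons_eq p b :
  Jterm z x u v (p :: p :: b) = w p * Jterm z x u v (p :: b).
Proof.
rewrite /Jterm /compS !compK_cons /= eqxx /= mulnS !exprD exprS /w exprMn.
ring.
Qed.

(** Removing the first part [p] reproduces the family, up to the factor [w p],
when the second part is again [p], and leaves a composition not starting with
[p] otherwise; the resulting equation for the sum is linear with the invertible
coefficient [1 - w p]. *)
Lemma Jsum_from p : (0 < p)%N ->
  fps_sum (compositions_from p) (Jterm z x u v) =
  Tgf z * (x ^+ p * (1 - z ^+ p) * (w p / (1 - w p))).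
Proof.
move=> p0; set J := fps_sum _ _.
have Js : fps_summable (compositions_from p) (Jterm z x u v).
  by apply: fps_summable_sub (Jterm_summable R) => a [].
have JE : J = x ^+ p * w p * ((1 - z ^+ p) * Tgf z) + w p * J.
  rewrite {1}/J (fps_sumID [set a | head 0%N (behead a) <> p]%classic) //.
  congr (_ + _).
    rewrite -size_series_head_neq // fps_sumMl; last first.
      by apply: size_series_summable => a [].
    transitivity (fps_sum (cons p @` [set b | composition b /\ head 0%N b <> p])%classic
                    (Jterm z x u v)).
      congr fps_sum; apply/seteqP; split.
        move=> [|q b] [[[cb _] //= qp] bp].
        by exists b; [split=> //; case/andP: cb | rewrite -qp].
      move=> _ [b [cb bp] <-].
      by split=> //; split=> //; split=> //=; rewrite p0.
    rewrite fps_sum_image; last by move=> a b [].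
    by apply: eq_fps_sum => b [_ bp]; apply: Jterm_cons_neq.
  rewrite fps_sumMl //.
  transitivity (fps_sum (cons p @` compositions_from p)%classic (Jterm z x u v)).
    congr fps_sum; apply/seteqP; split.
      move=> [|q b] [[[cb _] //= qp] /contrapT bp].
      exists b; last by rewrite -qp.
      split=> //; split; first by case/andP: cb.
      by move=> b0; rewrite b0 /= in bp; rewrite -bp in p0.
    move=> _ [b [[cb nb] bp] <-]; split; last by move=> /(_ bp).
    by split=> //; split=> //=; rewrite p0.
  rewrite fps_sum_image; last by move=> a b [].
  apply: eq_fps_sum => -[|q b] [[_ //= _]]; rewrite /compP /= => ->.
  exact: Jterm_cons_eq.
rewrite !mulrA; apply: (canRL (mulrK (run_denom_unit R p))).
rewrite -/u -/v -/z -/(w p) mulrBr mulr1 {1}JE /w.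
ring.
Qed.

End CompositionSeries.

Theorem theorem3p1 (R : comNzRingType) :
  let z := varz R in let x := varx R in let u := varu R in let v := varv R in
  Jgf z x u v =
    Tgf z * fps_sum [set p : nat | (1 <= p)%N]
              (fun p => x ^+ p * (1 - z ^+ p) *
                        ((u * (v * z) ^+ p) / (1 - u * (v * z) ^+ p))).
Proof.
move=> z x u v; rewrite fps_sumMl; last exact: run_sum_summable.
rewrite /Jgf (fps_sum_fibers (h := compP) (E := [set p | (1 <= p)%N])).
- by apply: eq_fps_sum => p p0; apply: Jsum_from.
- exact: Jterm_summable.
- by move=> [|p a] [ca] //= _; case/andP: ca.
Qed.
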